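(* Let $\mathbf{x}$ be a reversal-closed sequence. For all $n\ge 0$, \[ \tfrac{1}{2} \rho_{\mathbf{x}}(n) \leq r_{\mathbf{x}}(n) \leq \tfrac{1}{2} \rho_{\mathbf{x}}(n+1) + 1. \]
   Context: A factor of a sequence is a finite contiguous block. For $u=u(1)\cdots u(m)$, $u^R=u(m)\cdots u(1)$. $\mathbf{x}$ is reversal-closed if $w^R$ is a factor for every factor $w$. $\rho_{\mathbf{x}}(n)$ is the number of distinct length-$n$ factors; $r_{\mathbf{x}}(n)$ the number of distinct length-$n$ factors up to $u\sim v\iff v\in\{u,u^R\}$. *)

(* Defs.v *)
From mathcomp Require Import all_boot all_order all_algebra.
From mathcomp Require Import boolp.

Set Implicit Arguments.
Unset Strict Implicit.
Unset Printing Implicit Defensive.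

Definition is_factor (A : finType) (x : nat -> A) (w : seq A) : Prop :=
  exists i : nat, w = mkseq (fun j => x (i + j)) (size w).

Definition reversal_closed (A : finType) (x : nat -> A) : Prop :=
  forall w : seq A, is_factor x w -> is_factor x (rev w).

Definition factors (A : finType) (x : nat -> A) (n : nat) : {set n.-tuple A} :=
  [set w : n.-tuple A | `[< is_factor x w >]].

Definition factor_complexity (A : finType) (x : nat -> A) (n : nat) : nat :=
  #|factors x n|.

Definition rev_equiv (A : finType) (n : nat) : rel (n.-tuple A) :=
  fun u v => (v == u) || (v == rev_tuple u).

(* Number of classes of [rev_equiv] on the length-[n] factors, each class being
   taken inside [factors x n]; the definition does not presuppose that [x] is
   reversal-closed. *)
Definition reflection_complexity (A : finType) (x : nat -> A) (n : nat) : nat :=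
  #|equivalence_partition (@rev_equiv A n) (factors x n)|.

(* Main.v *)
(** Words of length [n + 1] are the edges of a connected graph on words of
    length [n], and reversal acts on it by reversing edges. In the quotient by
    reversal, every class [c] other than that of the prefix of [x] is first
    reached, along [x], through some edge [e] from an older class. Of the two end
    classes of [e], [c] is the later one, so [e] and its reversal determine [c];
    as these end classes differ, [e] is not a palindrome. This yields
    [2 * (r(n) - 1)] distinct factors of length [n + 1]. The lower bound holds
    because a class has at most two elements. *)
Require Import Defs.
From mathcomp Require Import all_boot all_order all_algebra.
From mathcomp Require Import boolp lra.

Set Implicit Arguments.
Unset Strict Implicit.
Unset Printing Implicit Defensive.

Import Order.TTheory GRing.Theory Num.Theory.
Local Open Scope ring_scope.

Definition word_at (A : finType) (x : nat -> A) (n i : nat) : n.-tuple A :=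
  [tuple x (i + j)%N | j < n].

Lemma nth_word_at (A : finType) (x : nat -> A) a (n i j : nat) :
  (j < n)%N -> nth a (word_at x n i) j = x (i + j)%N.
Proof. by move=> jn; rewrite -(tnth_nth a _ (Ordinal jn)) tnth_mktuple. Qed.

Lemma val_word_at (A : finType) (x : nat -> A) (n i : nat) :
  val (word_at x n i) = mkseq (fun j => x (i + j)%N) n.
Proof.
apply: (@eq_from_nth _ (x 0%N)) => [|j]; rewrite size_tuple ?size_mkseq // => jn.
by rewrite nth_word_at // nth_mkseq.
Qed.

Lemma mem_factorsP (A : finType) (x : nat -> A) (n : nat) (w : n.-tuple A) :
  reflect (exists i, w = word_at x n i) (w \in factors x n).
Proof.
rewrite inE; apply: (iffP (asboolP _)) => -[i wE]; exists i.
  by apply: val_inj; rewrite val_word_at [LHS]wE size_tuple.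
by rewrite size_tuple wE val_word_at.
Qed.

Lemma word_at_factor (A : finType) (x : nat -> A) (n i : nat) :
  word_at x n i \in factors x n.
Proof. by apply/mem_factorsP; exists i. Qed.

Lemma rev_tupleK (A : finType) (n : nat) : involutive (@rev_tuple n A).
Proof. by move=> w; apply: val_inj; rewrite /= revK. Qed.

Lemma rev_factor (A : finType) (x : nat -> A) (n : nat) (w : n.-tuple A) :
  reversal_closed x -> w \in factors x n -> rev_tuple w \in factors x n.
Proof. by move=> hx; rewrite !inE => /asboolP wx; apply/asboolP/hx. Qed.

(** Dropping the first letter shows that the target of an edge depends only on the edge as a word,
    not on the position where it is read. *)
Lemma word_at_eqS (A : finType) (x : nat -> A) (n i j : nat) :
  word_at x n.+1 i = word_at x n.+1 j -> word_at x n i.+1 = word_at x n j.+1.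
Proof.
move=> e; apply: eq_from_tnth => k; rewrite !tnth_mktuple !addSnnS.
have kn : (k.+1 < n.+1)%N by rewrite ltnS.
by rewrite -!(nth_word_at x (x 0%N) _ kn) e.
Qed.

Lemma nth_rev_tuple (A : finType) (n : nat) a (w : n.-tuple A) (j : nat) :
  (j < n)%N -> nth a (rev_tuple w) j = nth a w (n - j.+1).
Proof. by move=> jn; rewrite nth_rev size_tuple. Qed.

(** Reversal exchanges the two ends of an edge: the source of a reversed edge is the reversal of the
    original target. *)
Lemma word_at_eq_rev (A : finType) (x : nat -> A) (n i j : nat) :
  word_at x n.+1 i = rev_tuple (word_at x n.+1 j) ->
  word_at x n i = rev_tuple (word_at x n j.+1).
Proof.
move=> e; apply: eq_from_tnth => k; rewrite !(tnth_nth (x 0%N)).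
have kn : (k < n.+1)%N := ltnW (ltn_ord k).
rewrite nth_rev_tuple // !nth_word_at //; last first.
  by rewrite ltn_subrL /= (leq_ltn_trans _ (ltn_ord k)).
rewrite -(nth_word_at x (x 0%N) _ kn) e nth_rev_tuple //.
rewrite nth_word_at ?subSS ?ltnS ?leq_subr //.
by rewrite addSnnS -subSn.
Qed.

Lemma rev_equiv_equivalence (A : finType) (n : nat) : equivalence_rel (@rev_equiv A n).
Proof.
move=> u v w; split; first by rewrite /rev_equiv eqxx.
by rewrite /rev_equiv => /orP[]/eqP-> //; rewrite rev_tupleK orbC.
Qed.

Notation rev_classes x n :=
  (equivalence_partition (@rev_equiv _ n) (factors x n)).

Lemma rev_classes_partition (A : finType) (x : nat -> A) (n : nat) :
  partition (rev_classes x n) (factors x n).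
Proof. by apply: equivalence_partitionP => u v w _ _ _; apply: rev_equiv_equivalence. Qed.

Lemma factor_complexity_le (A : finType) (x : nat -> A) (n : nat) :
  (factor_complexity x n <= 2 * reflection_complexity x n)%N.
Proof.
rewrite /factor_complexity (card_partition (rev_classes_partition x n)).
rewrite mulnC -sum_nat_const; apply: leq_sum => c /imsetP[u _ ->].
apply: leq_trans (_ : #|[set u; rev_tuple u]| <= 2)%N; last first.
  by rewrite cards2; case: (_ == _).
by apply/subset_leq_card/subsetP => v; rewrite !inE => /andP[].
Qed.

(** Classes are cut out inside the set of factors, so it takes reversal closure to keep the reversed
    word in the class. *)
Lemma mem_rev_class (A : finType) (x : nat -> A) (n : nat) c (w : n.-tuple A) :
  reversal_closed x -> c \in rev_classes x n -> w \in c -> rev_tuple w \in c.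
Proof.
move=> hx /imsetP[u _ ->]; rewrite in_set => /andP[wx uw].
rewrite in_set rev_factor //= (rev_equiv_equivalence u w _).2 //.
by rewrite /rev_equiv eqxx orbT.
Qed.

Lemma first_occurrence (A : finType) (x : nat -> A) (n : nat) c :
  c \in rev_classes x n ->
  exists i, word_at x n i \in c /\
    forall j, word_at x n j \in c -> (i <= j)%N.
Proof.
move=> cP; have /and3P[/eqP covP _ P0] := rev_classes_partition x n.
have exi : exists i, word_at x n i \in c.
  have /set0Pn[w wc] : c != set0 by apply: contraNneq P0 => <-.
  have /mem_factorsP[i wE] : w \in factors x n.
    by rewrite -covP; apply/bigcupP; exists c.
  by exists i; rewrite -wE.
by case: (ex_minnP exi) => i ic imin; exists i.
Qed.

Lemma reflection_complexity_le (A : finType) (x : nat -> A) (n : nat) :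
  reversal_closed x ->
  (2 * reflection_complexity x n <= factor_complexity x n.+1 + 2)%N.
Proof.
move=> hx; rewrite /reflection_complexity; set P := rev_classes x n.
have /and3P[/eqP covP tiP _] : partition P (factors x n) :=
  rev_classes_partition x n.
(* [f c] is the first position at which the class [c] is visited; outside [P] the value 0 is a mere
   default. *)
have /choice[f fP] (c : {set n.-tuple A}) : exists i, c \in P ->
    word_at x n i \in c /\ forall j, word_at x n j \in c -> (i <= j)%N.
  by have [/first_occurrence[i ?]|_] := boolP (c \in P); [exists i | exists 0%N].
pose c0 := pblock P (word_at x n 0).
have c0P : c0 \in P by rewrite pblock_mem // covP word_at_factor.
(* Position 0 already lies in [c0], and blocks are disjoint. Hence [(f c).-1] below is a true
   predecessor, and [e c] is the edge along which [c] is first entered. *)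
have f_gt0 c : c \in P :\ c0 -> (0 < f c)%N.
  rewrite 2!inE => /andP[cc0 cP]; have [fc _] := fP c cP.
  rewrite lt0n; apply: contraNneq cc0 => f0.
  by rewrite /c0 eq_sym -(def_pblock tiP cP fc) f0.
pose e c := word_at x n.+1 (f c).-1.
have e_inj c d : c \in P :\ c0 -> d \in P :\ c0 -> e c = e d -> c = d.
  move=> cP dP /word_at_eqS; rewrite !prednK ?f_gt0 // => ecd.
  have [/setD1P[_ {}cP] /setD1P[_ {}dP]] := (cP, dP).
  have [[fc _] [fd _]] := (fP c cP, fP d dP).
  by rewrite -(def_pblock tiP cP fc) ecd (def_pblock tiP dP fd).
(* The source of [e d] is then the reversal of the target of [e c], so it lies in [c]; thus [c] is
   visited by position [(f d).-1]. *)
have e_rev_lt c d : c \in P :\ c0 -> d \in P :\ c0 ->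
    e d = rev_tuple (e c) -> (f c < f d)%N.
  move=> cP dP /word_at_eq_rev; rewrite prednK ?f_gt0 // => ecd.
  rewrite -[f d]prednK ?f_gt0 // ltnS.
  have /setD1P[_ {}cP] := cP; have [fc fmin] := fP c cP.
  by apply: fmin; rewrite ecd (mem_rev_class hx cP).
(* The relation is symmetric in [c] and [d], so it would give both strict inequalities. The case
   [c = d] says that [e c] is not a palindrome. *)
have e_neq_rev c d : c \in P :\ c0 -> d \in P :\ c0 -> e d <> rev_tuple (e c).
  move=> cP dP ecd; have := e_rev_lt c d cP dP ecd.
  have : (f d < f c)%N by apply: e_rev_lt; rewrite // ecd rev_tupleK.
  by move=> /ltn_trans /[apply]; rewrite ltnn.
(* The boolean selects the orientation of the edge, so each class other than [c0] contributes two
   factors. *)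
pose g (p : {set n.-tuple A} * bool) := if p.2 then e p.1 else rev_tuple (e p.1).
have g_inj : {in setX (P :\ c0) [set: bool] &, injective g}.
  move=> [c b] [d b'] /setXP[cP _] /setXP[dP _]; rewrite /g /=.
  case: b b' => [] [] ecd.
  - by rewrite (e_inj c d).
  - by have := e_neq_rev d c dP cP ecd.
  - by have := e_neq_rev c d cP dP (esym ecd).
  - by rewrite (e_inj c d) //; apply: (inv_inj (@rev_tupleK A n.+1)).
have : (#|g @: setX (P :\ c0) [set: bool]| <= factor_complexity x n.+1)%N.
  apply/subset_leq_card/subsetP => _ /imsetP[[c b] _ ->]; rewrite /g /=.
  by case: b; rewrite ?rev_factor ?word_at_factor.
(* Leaving out [c0] costs one class, which when doubled is the [+ 2] of the bound. *)
rewrite card_in_imset // cardsX cardsT card_bool (cardsD1 c0 P) c0P.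
by rewrite mulnDr addnC leq_add2r mulnC.
Qed.

Theorem theorem3p13 (A : finType) (x : nat -> A) (hx : reversal_closed x)
    (n : nat) :
  (1 / 2 * (factor_complexity x n)%:R <= (reflection_complexity x n)%:R :> rat)
  /\
  ((reflection_complexity x n)%:R
     <= 1 / 2 * (factor_complexity x n.+1)%:R + 1 :> rat).
Proof.
have := factor_complexity_le x n; have := reflection_complexity_le n hx.
by rewrite -!(ler_nat rat) natrD !natrM => ? ?; split; lra.
Qed.
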